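(* Let $T[1..n]$ be a string as described in the context and let $r$ be the number of runs of its BWT $\mathsf{L}$. Then the total number of net occurrences in $T$, i.e. $\sum_{x}\mathsf{NF}(x)$ where $x$ ranges over all repeats of $T$ (including the empty string), is less than $2r$.
   Context: Alphabet $\Sigma_{\$}=[1..\sigma]$ is ordered with smallest character $\$$. $T[1..n]$ ($n\ge 2$) contains every character of $\Sigma_{\$}$, $T[n]=\$$, $\$$ does not occur in $T[1..n-1]$, and by convention $T[0]=\$$. A position $b\in[1..n]$ is an occurrence of $x$ if $T[b..b+|x|-1]=x$; $\mathsf{Occ}(x)$ is the set of occurrences. $x$ is a repeat if $|\mathsf{Occ}(x)|\ge 2$ and unique if $|\mathsf{Occ}(x)|=1$; by convention the empty string $\varepsilon$ is a repeat with $\mathsf{Occ}(\varepsilon)=[1..n]$. An occurrence $b$ of a nonempty repeat $x$ is a net occurrence if there is no occurrence $b'$ of another repeat $x'$ with $[b..b+|x|)\subsetneq[b'..b'+|x'|)$; for $\varepsilon$, an occurrence $b$ is a net occurrence iff the one-character strings $T[b-1]$ and $T[b]$ are both unique in $T$. $\mathsf{NF}(x)$ (net frequency) is the number of net occurrences of $x$. The suffix array $\mathsf{SA}[1..n]$ is the permutation with $T[\mathsf{SA}[i]..n]$ the lexicographically $i$-th nonempty suffix, and the BWT is the string $\mathsf{L}[i]=T[\mathsf{SA}[i]-1]$. A run of $\mathsf{L}$ is a maximal block of equal consecutive characters; $r$ is the number of runs. *)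

(* Defs.v *)
From mathcomp Require Import all_boot all_order.

Set Implicit Arguments.
Unset Strict Implicit.
Unset Printing Implicit Defensive.

(* The ordered alphabet [1..sigma] is 'I_s.+1 with sigma = s.+1 (character c is
   encoded as c - 1), so that its smallest character $ is ord0. Positions of T
   are numbered from 1 as in T[1..n], with n = size T. *)

Definition dollar (s : nat) : 'I_s.+1 := ord0.

(* T[i]; the extra head implements the convention T[0] = $. *)
Definition char_at (s : nat) (T : seq 'I_s.+1) (i : nat) : 'I_s.+1 :=
  nth (dollar s) (dollar s :: T) i.

Definition is_text (s : nat) (T : seq 'I_s.+1) : Prop :=
  [/\ 2 <= size T,
      forall c : 'I_s.+1, c \in T,
      char_at T (size T) = dollar s
    & forall i, 1 <= i < size T -> char_at T i <> dollar s].

(* T[b..b+m-1], truncated at the end of T. *)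
Definition substr (s : nat) (T : seq 'I_s.+1) (b m : nat) : seq 'I_s.+1 :=
  take m (drop b.-1 T).

Definition is_occ (s : nat) (T x : seq 'I_s.+1) (b : nat) : bool :=
  (1 <= b <= size T) && (substr T b (size x) == x).

(* 'I_(size T).+1 only serves as a finite type containing [1..n]. *)
Definition Occ (s : nat) (T x : seq 'I_s.+1) : {set 'I_(size T).+1} :=
  [set b : 'I_(size T).+1 | is_occ T x b].

Definition is_repeat (s : nat) (T x : seq 'I_s.+1) : bool := 2 <= #|Occ T x|.

Definition is_unique (s : nat) (T x : seq 'I_s.+1) : bool := #|Occ T x| == 1.

(* [b..b+m), for intervals contained in [1..n]. *)
Definition span (s : nat) (T : seq 'I_s.+1) (b m : nat) :
    {set 'I_(size T).+1} :=
  [set i : 'I_(size T).+1 | b <= i < b + m].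

(* Every string occurring in T has length at most n, so quantifying over
   (size T).-bseq 'I_s.+1 reaches all repeats. *)
Definition is_net_occ (s : nat) (T x : seq 'I_s.+1) (b : nat) : bool :=
  is_occ T x b &&
  (if x is [::] then
     is_unique T [:: char_at T b.-1] && is_unique T [:: char_at T b]
   else
     ~~ [exists x' : (size T).-bseq 'I_s.+1, exists b' : 'I_(size T).+1,
           [&& is_repeat T x', x != x' :> seq 'I_s.+1, is_occ T x' b'
             & span T b (size x) \proper span T b' (size x')]]).

Definition NF (s : nat) (T x : seq 'I_s.+1) : nat :=
  #|[set b : 'I_(size T).+1 | is_net_occ T x b]|.

Definition suffix_at (s : nat) (T : seq 'I_s.+1) (i : nat) :
    seqlexi 'I_s.+1 :=
  drop i.-1 T.

Definition SA (s : nat) (T : seq 'I_s.+1) : seq nat :=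
  sort (fun i j => (suffix_at T i <= suffix_at T j)%O) (iota 1 (size T)).

Definition bwt (s : nat) (T : seq 'I_s.+1) : seq 'I_s.+1 :=
  [seq char_at T i.-1 | i <- SA T].

(* The block of L from index i to index j, both included, numbered from 0. *)
Definition is_block (A : eqType) (L : seq A) (i j : nat) : bool :=
  (i <= j < size L) && constant (take (j - i).+1 (drop i L)).

Definition is_run (A : eqType) (L : seq A) (i j : nat) : bool :=
  is_block L i j &&
  [forall i' : 'I_(size L), forall j' : 'I_(size L),
     [&& is_block L i' j', i' <= i & j <= j'] ==>
     ((i' == i :> nat) && (j' == j :> nat))].

Definition nruns (A : eqType) (L : seq A) : nat :=
  #|[set p : 'I_(size L) * 'I_(size L) | is_run L p.1 p.2]|.

(* Main.v *)
Require Import Defs.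
From mathcomp Require Import all_boot all_order.
From mathcomp Require Import zify.

(* A net occurrence b of a repeat x has a unique right extension, so x is the
   longest repeat occurring at b: each position carries at most one net
   occurrence. The suffixes with prefix x are consecutive in the suffix array,
   and there are at least two of them, so a neighbour b' of b in the suffix
   array is an occurrence of x too. As the left extension of x at b is unique,
   T[b-1] <> T[b'-1], hence b lies next to one of the r - 1 boundaries between
   runs of the BWT. Every boundary has two sides, which gives at most 2(r - 1)
   net occurrences. *)

Set Implicit Arguments.
Unset Strict Implicit.
Unset Printing Implicit Defensive.

(** * Runs of a sequence and the boundaries between them *)

Section Runs.

Variables (A : eqType) (x0 : A) (L : seq A).

Lemma is_blockP (i j : nat) :
  reflect (i <= j < size L /\ forall k, i <= k <= j -> nth x0 L k = nth x0 L i)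
          (is_block L i j).
Proof.
apply: (iffP andP) => -[hij h]; split=> //.
  move=> k hk; have hi : i < size L by lia.
  move: h; rewrite (drop_nth x0 hi) /= => /(all_nthP x0) h.
  have [->//|nki] := eqVneq k i.
  have hs : k - i.+1 < size (take (j - i) (drop i.+1 L)).
    by rewrite size_take_min size_drop; lia.
  move: (h _ hs); rewrite nth_take; last by lia.
  by rewrite nth_drop subnKC /= => [/eqP//|]; lia.
have hi : i < size L by lia.
rewrite (drop_nth x0 hi) /=; apply/(all_nthP x0) => k.
rewrite size_take_min size_drop => hk.
rewrite nth_take; last by lia.
by rewrite nth_drop /= h //; lia.
Qed.

(** A boundary is recorded by the index on its right-hand side. *)
Definition run_boundaries : {set 'I_(size L)} :=
  [set i : 'I_(size L) | (0 < i) && (nth x0 L i.-1 != nth x0 L i)].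

(** The run is the block starting at [i] that reaches furthest. It cannot be extended to the left,
    since a block starting before [i] would contain both [i.-1] and [i], where the entries
    differ. *)
Lemma run_from (i : 'I_(size L)) :
  (i == 0 :> nat) || (nth x0 L i.-1 != nth x0 L i) ->
  exists j : 'I_(size L), is_run L i j.
Proof.
move=> start_i.
have Pi : is_block L i i.
  apply/is_blockP; split=> [|k hk]; first by rewrite leqnn ltn_ord.
  by congr nth; lia.
case: (@arg_maxnP _ i (fun j => is_block L i j) (@nat_of_ord _) Pi) => j Pj maxj.
exists j; apply/andP; split=> //.
apply/forallP => i'; apply/forallP => j'; apply/implyP => /and3P[hb hi' hj'].
have /is_blockP[hij hk] := hb; have /is_blockP[hj _] := Pj.
have ei : i' = i :> nat.
  case/orP: start_i => [/eqP i0|]; first by lia.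
  case: (ltngtP (i' : nat) i) => [lt||] //; last by lia.
  by rewrite (hk i.-1) ?(hk i) ?eqxx //; lia.
rewrite ei eqxx /=.
have : is_block L i j' by rewrite -ei.
by move/maxj; move: hj' => /=; lia.
Qed.

(** Index 0 and every boundary are starts of runs, so they all lie in the image of the runs under
    the first projection. Index 0 is not a boundary, which makes the inequality strict. *)
Lemma card_run_boundaries : 0 < size L -> #|run_boundaries| < nruns L.
Proof.
move=> L_gt0; pose o : 'I_(size L) := Ordinal L_gt0.
have oNB : o \notin run_boundaries by rewrite inE.
have -> : #|run_boundaries|.+1 = #|o |: run_boundaries| by rewrite cardsU1 oNB.
pose R := [set p : 'I_(size L) * 'I_(size L) | is_run L p.1 p.2].
apply: (@leq_trans #|[set p.1 | p in R]|); last exact: leq_imset_card.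
apply/subset_leq_card/subsetP => i; rewrite !inE => hi.
have [|j hj] := @run_from i.
  by case/orP: hi => [/eqP->//|/andP[_ ->]]; rewrite orbT.
by apply/imsetP; exists (i, j); rewrite ?inE.
Qed.

End Runs.

(** The first character of [v] is squeezed between two copies of that of [x], hence equal to it; the
    comparisons then pass to the tails. *)
Lemma lexi_prefix_between (d : Order.disp_t) (A : orderType d)
    (x u v w : seqlexi A) :
  (u <= v)%O -> (v <= w)%O -> prefix x u -> prefix x w -> prefix x v.
Proof.
elim: x u v w => [//|a x IH] [|b u] [|c v] [|e w] //.
rewrite !Order.SeqLexiOrder.Exports.lexi_cons => /andP[bc huv] /andP[ce hvw].
rewrite !prefix_cons => /andP[/eqP ab xu] /andP[/eqP ae xw].
have ac : a = c.
  by apply/Order.POrderTheory.le_anti/andP; split; [rewrite ab | rewrite ae].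
move: huv hvw; rewrite -ab -ae -ac Order.POrderTheory.lexx /= => huv hvw.
by rewrite ac eqxx (IH _ _ _ huv hvw xu xw).
Qed.

(** * Occurrences, repeats and net occurrences *)

Section NetOccurrences.

Variables (s : nat) (T : seq 'I_s.+1).
Implicit Types x y : seq 'I_s.+1.

Lemma is_occE x b : is_occ T x b = (1 <= b <= size T) && prefix x (drop b.-1 T).
Proof. by rewrite /is_occ /substr prefixE. Qed.

Lemma occ_cons c x b :
  0 < b < size T -> is_occ T x b.+1 -> char_at T b = c -> is_occ T (c :: x) b.
Proof.
case: b => // b /= hb; rewrite !is_occE /= => /andP[_ hx] <-.
rewrite (drop_nth (dollar s)) ?prefix_cons; last by lia.
by rewrite /char_at /= eqxx hx andbT; lia.
Qed.

Lemma occ_head c x b : is_occ T (c :: x) b -> char_at T b = c.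
Proof.
case: b => // b; rewrite is_occE /= => /andP[hb].
by rewrite (drop_nth (dollar s)) ?prefix_cons //= => /andP[/eqP-> _].
Qed.

Lemma occ_size x b : is_occ T x b -> b + size x <= (size T).+1.
Proof.
rewrite is_occE => /andP[hb /size_prefix].
by rewrite size_drop /=; lia.
Qed.

Lemma occ_prefix x y b : prefix x y -> is_occ T y b -> is_occ T x b.
Proof.
by move=> xy; rewrite !is_occE => /andP[-> yb]; apply: prefix_trans xy yb.
Qed.

Lemma repeatP x :
  reflect (exists b c : 'I_(size T).+1,
             [/\ is_occ T x b, is_occ T x c & b != c])
          (is_repeat T x).
Proof.
apply: (iffP card_gt1P) => -[b [c [xb xc nbc]]]; exists b, c.
  by rewrite !inE in xb xc.
by rewrite !inE.
Qed.

Lemma repeat_of_occs x b c :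
  is_occ T x b -> is_occ T x c -> b != c -> is_repeat T x.
Proof.
move=> xb xc nbc; apply/repeatP.
have hb : b < (size T).+1 by move: xb => /andP[]; lia.
have hc : c < (size T).+1 by move: xc => /andP[]; lia.
by exists (Ordinal hb), (Ordinal hc).
Qed.

Lemma repeat_prefix x y : prefix x y -> is_repeat T y -> is_repeat T x.
Proof.
move=> xy /repeatP[b [c [yb yc nbc]]].
by apply: repeat_of_occs (occ_prefix xy yb) (occ_prefix xy yc) nbc.
Qed.

Lemma repeat_nunique x : is_repeat T x -> ~~ is_unique T x.
Proof. by rewrite /is_repeat /is_unique; case: #|_| => [|[]]. Qed.

(** Stated with endpoints and lengths rather than spans, so that it applies to extensions on the
    right ([b' = b]) and on the left ([b' = b.-1]) alike. *)
Lemma net_occ_maximal x y b b' :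
  x <> [::] -> is_net_occ T x b -> is_repeat T y -> is_occ T y b' ->
  b' <= b -> b + size x <= b' + size y -> size x < size y -> False.
Proof.
move=> xN /andP[xb]; case: x xN xb => // a x _ xb /existsP nex ry yb hl hr hs.
apply: nex; have hy := occ_size yb; have b'_gt0 : 0 < b' by case/andP: yb; lia.
have sy : size y <= size T by lia.
have hb' : b' < (size T).+1 by case/andP: yb; lia.
exists (Bseq sy); apply/existsP; exists (Ordinal hb'); rewrite /= ry yb /=.
rewrite /= in hr hs.
apply/andP; split.
  by apply/eqP => e; rewrite -e ltnn in hs.
rewrite properEneq; apply/andP; split; last first.
  by apply/subsetP => i; rewrite !inE /=; lia.
apply/eqP => /setP e.
(* A point of the larger span outside the smaller one: [b'] if it lies to the left of [b], otherwise
   the first position after the occurrence of [x]. *)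
have [lt|le] := ltnP b' b.
  by have := e (Ordinal hb'); rewrite !inE /=; lia.
have h : b + (size x).+1 < (size T).+1 by lia.
by have := e (Ordinal h); rewrite !inE /=; lia.
Qed.

Lemma net_occ_size_le x y b :
  is_repeat T y -> is_net_occ T x b -> is_occ T y b -> size y <= size x.
Proof.
move=> ry xb yb; rewrite leqNgt; apply/negP => lt.
case: x xb lt => [|a x] xb lt; last first.
  by apply: (net_occ_maximal _ xb ry yb) => //; rewrite leq_add2l ltnW.
(* For empty [x], the first character of [y] is itself a repeat, against the uniqueness of T[b]. *)
case: y ry yb lt => // c y ry yb _.
case/andP: xb => _ /andP[_]; rewrite (occ_head yb); apply/negP.
by apply: repeat_nunique; apply: repeat_prefix ry; rewrite prefix_cons eqxx prefix0s.
Qed.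

Lemma net_occ_inj x y b :
  is_repeat T x -> is_repeat T y -> is_net_occ T x b -> is_net_occ T y b ->
  x = y.
Proof.
move=> rx ry nx ny; have /andP[ox _] := nx; have /andP[oy _] := ny.
have e : size x = size y.
  by apply/eqP; rewrite eqn_leq !(net_occ_size_le rx ny, net_occ_size_le ry nx).
by move: ox oy => /andP[_ /eqP<-] /andP[_ /eqP<-]; rewrite e.
Qed.

Hypothesis hT : is_text T.

(** Were the two characters equal, prepending this character to [x] would give a repeat that occurs
    at [b.-1] and extends the net occurrence to the left. *)
Lemma net_occ_left x b c :
  is_net_occ T x b -> is_occ T x c -> b != c ->
  char_at T b.-1 != char_at T c.-1.
Proof.
case: hT => _ _ _ ndollar nx xc nbc; have /andP[xb _] := nx.
have hb : 0 < b <= size T by case/andP: xb.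
have hc : 0 < c <= size T by case/andP: xc.
apply/eqP => e.
(* If [b] or [c] is 1, its left character is T[0] = $, while the other one is read at a position in
   [1..n-1], where $ does not occur. *)
have [b1|b1] := eqVneq b 1.
  by apply: (@ndollar c.-1); [lia | rewrite -e b1].
have [c1|c1] := eqVneq c 1.
  by apply: (@ndollar b.-1); [lia | rewrite e c1].
have axb : is_occ T (char_at T b.-1 :: x) b.-1.
  by apply: occ_cons => //; [lia | rewrite prednK //; lia].
have axc : is_occ T (char_at T b.-1 :: x) c.-1.
  by apply: occ_cons => //; [lia | rewrite prednK //; lia].
have rax : is_repeat T (char_at T b.-1 :: x).
  by apply: repeat_of_occs axb axc _; lia.
case: x {xb xc axc} nx axb rax => [|a x] nx axb rax.
  by case/andP: nx => _ /andP[+ _]; apply/negP/repeat_nunique.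
by apply: (net_occ_maximal _ nx rax axb) => //=; lia.
Qed.

(** * The suffix array and the BWT *)

Lemma size_SA : size (SA T) = size T.
Proof. by rewrite size_sort size_iota. Qed.

Lemma mem_SA b : (b \in SA T) = (0 < b <= size T).
Proof. by rewrite mem_sort mem_iota; lia. Qed.

Lemma SA_uniq : uniq (SA T).
Proof. by rewrite sort_uniq iota_uniq. Qed.

Lemma SA_le i j :
  i <= j < size T ->
  (suffix_at T (nth 0 (SA T) i) <= suffix_at T (nth 0 (SA T) j))%O.
Proof.
move=> hij.
have tr : transitive (fun i j => suffix_at T i <= suffix_at T j)%O.
  by move=> ? ? ?; apply: Order.POrderTheory.le_trans.
apply: (sorted_leq_nth tr) => //; rewrite ?inE ?size_SA; try lia.
apply: sort_sorted => ? ?; exact: Order.TotalTheory.le_total.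
Qed.

Lemma occ_between x i j k :
  i <= j <= k -> k < size T ->
  is_occ T x (nth 0 (SA T) i) -> is_occ T x (nth 0 (SA T) k) ->
  is_occ T x (nth 0 (SA T) j).
Proof.
move=> hijk hk; rewrite !is_occE => /andP[_ xi] /andP[_ xk].
rewrite -mem_SA mem_nth ?size_SA /=; last by lia.
by apply: lexi_prefix_between (SA_le _) (SA_le _) xi xk; lia.
Qed.

Lemma size_bwt : size (bwt T) = size T.
Proof. by rewrite size_map size_SA. Qed.

Lemma nth_bwt i :
  i < size T -> nth (dollar s) (bwt T) i = char_at T (nth 0 (SA T) i).-1.
Proof. by move=> hi; rewrite (nth_map 0) // size_SA. Qed.

Lemma net_occ_near_boundary x b :
  is_repeat T x -> is_net_occ T x b ->
  exists2 i, i \in run_boundaries (dollar s) (bwt T)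
           & b = nth 0 (SA T) i \/ b = nth 0 (SA T) i.-1.
Proof.
move=> /repeatP[c1 [c2 [xc1 xc2 nc]]] nx.
have [c xc ncb] : exists2 c, is_occ T x c & c != b.
  have [e|ne] := eqVneq (c1 : nat) b; last by exists c1.
  by exists c2 => //; rewrite -e eq_sym.
have /andP[xb _] := nx.
have bSA : b \in SA T by rewrite mem_SA; case/andP: xb.
have cSA : c \in SA T by rewrite mem_SA; case/andP: xc.
have hi : index b (SA T) < size T by rewrite -size_SA index_mem.
have hj : index c (SA T) < size T by rewrite -size_SA index_mem.
have eb := nth_index 0 bSA; have ec := nth_index 0 cSA.
set i := index b _ in hi eb; set j := index c _ in hj ec.
have neq k : k < size T -> k != i -> is_occ T x (nth 0 (SA T) k) ->
    nth (dollar s) (bwt T) i != nth (dollar s) (bwt T) k.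
  move=> hk nki xk; rewrite !nth_bwt // eb; apply: net_occ_left nx xk _.
  by rewrite -eb nth_uniq ?size_SA ?SA_uniq // eq_sym.
have nij : j != i.
  by apply: contraNneq ncb => e; rewrite -ec -eb e.
(* The neighbour of [i] on the side of [j] also carries an occurrence of [x]. The boundary is [i]
   itself if [j] is smaller, with [b] on its right; otherwise it is [i.+1], with [b] on its left. *)
have [lt|le] := ltnP j i.
  have hi' : i < size (bwt T) by rewrite size_bwt.
  exists (Ordinal hi'); last by left.
  rewrite inE /= eq_sym neq ?andbT; try lia.
  by apply: (@occ_between _ j _ i); rewrite ?ec ?eb //; lia.
have hi' : i.+1 < size (bwt T) by rewrite size_bwt; lia.
exists (Ordinal hi'); last by right.
rewrite inE /= neq ?andbT; rewrite size_bwt in hi'; try lia.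
by apply: (@occ_between _ i _ j); rewrite ?ec ?eb //; lia.
Qed.

(** * Counting net occurrences by position *)

Definition net_positions : {set 'I_(size T).+1} :=
  [set b : 'I_(size T).+1 |
     [exists x : (size T).-bseq 'I_s.+1, is_repeat T x && is_net_occ T x b]].

(** Double counting: after exchanging the sums, each position contributes at most 1, because
    [net_occ_inj] allows only one repeat there. *)
Lemma sum_NF_le :
  \sum_(x : (size T).-bseq 'I_s.+1 | is_repeat T x) NF T x <= #|net_positions|.
Proof.
rewrite (eq_bigr (fun x : (size T).-bseq 'I_s.+1 =>
    \sum_(b : 'I_(size T).+1) (is_net_occ T x b : nat))); last first.
  move=> x _; rewrite /NF -sum1dep_card big_mkcond.
  by apply: eq_bigr => b _; case: is_net_occ.
rewrite exchange_big /= -sum1_card [X in _ <= X]big_mkcond; apply: leq_sum => b _.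
rewrite inE; case: existsP => [[x /andP[rx nx]]|nex]; last first.
  rewrite big1 // => x rx; case nx: is_net_occ => //.
  by case: nex; exists x; rewrite rx nx.
rewrite (bigD1 x) //= nx big1 ?addn0 // => y /andP[ry nyx].
case ny: is_net_occ => //; case/eqP: nyx; apply/val_inj.
exact: net_occ_inj ny nx.
Qed.

(** The net positions are covered by two images of the set of boundaries, one for each side. *)
Lemma card_net_positions :
  #|net_positions| <= 2 * #|run_boundaries (dollar s) (bwt T)|.
Proof.
set D := run_boundaries _ _; pose pos k : 'I_(size T).+1 := inord (nth 0 (SA T) k).
apply: (@leq_trans #|[set pos i | i : 'I__ in D] :|: [set pos i.-1 | i : 'I__ in D]|).
  apply/subset_leq_card/subsetP => b.
  rewrite inE => /existsP[x /andP[rx nx]].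
  have [i iD [eb|eb]] := net_occ_near_boundary rx nx; rewrite inE; apply/orP.
    by left; apply/imsetP; exists i => //; rewrite /pos -eb inord_val.
  by right; apply/imsetP; exists i => //; rewrite /pos -eb inord_val.
rewrite mul2n -addnn (leq_trans (leq_card_setU _ _)) //.
by rewrite leq_add ?leq_imset_card.
Qed.

End NetOccurrences.

Theorem theorem1 (s : nat) (T : seq 'I_s.+1) (hT : is_text T) :
  \sum_(x : (size T).-bseq 'I_s.+1 | is_repeat T x) NF T x
    < 2 * nruns (bwt T).
Proof.
apply: leq_ltn_trans (sum_NF_le T) _.
apply: leq_ltn_trans (card_net_positions hT) _.
rewrite ltn_pmul2l //; apply: card_run_boundaries.
by rewrite size_bwt; case: hT => /ltnW.
Qed.
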